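(* Let $k\geq 1$ be an integer and let $G$ be a $k$-tree with $n$ vertices. Then in the blind variant $$\max_{0\leq l\leq n}CC[l]<\frac{k^k}{(k+1)^{k+1}}n+1,$$ and stopping after $l=\frac{1}{k+1}n$ vertices is optimal up to an additive constant: if $\frac{1}{k+1}n$ is an integer, then $$\frac{k^k}{(k+1)^{k+1}}n-\frac{k+2}{e}<CC\left[\frac{1}{k+1}n\right]\leq\max_{0\leq l\leq n}CC[l]<\frac{k^k}{(k+1)^{k+1}}n+1.$$
   Context: A graph $G$ with $n\ge k$ vertices is maximal $k$-degenerate if there is an ordering $v_1,\dots,v_n$ of its vertices such that the first $k$ vertices form a clique $K_k$ and each of the remaining vertices is joined to exactly $k$ vertices earlier in the ordering. Fix such an ordering. For a vertex $v$ not among the first $k$, $M_v$ denotes the set of its exactly $k$ neighbors that are earlier in the ordering; for the initial vertices $M_{v_i}=\{v_1,\dots,v_{i-1}\}$, $i\le k$. A $k$-tree is a maximal $k$-degenerate graph (with such an ordering) for which all sets $M_v$ are cliques. The vertices of $G$ become active one by one in a uniformly random order (permutation) $\sigma\in S_n$. In the blind variant of the optimal stopping problem the algorithm knows during the game only the number of active vertices, so it stops at a fixed time $l\in\{0,\dots,n\}$ independent of $\sigma$. $CC[l]$ denotes the expected number of connected components of the induced subgraph $G[\{\sigma(1),\dots,\sigma(l)\}]$ for uniformly random $\sigma$. *)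

(* Defs.v *)
From mathcomp Require Import all_boot all_order all_algebra all_fingroup.
From mathcomp Require Import reals.

Set Implicit Arguments.
Unset Strict Implicit.
Unset Printing Implicit Defensive.

Import Order.TTheory GRing.Theory Num.Theory.

Local Open Scope ring_scope.

(* A simple graph on n vertices is a symmetric irreflexive relation on 'I_n.
   Vertex orderings are permutations v : 'S_n, read as v 0, ..., v (n-1):
   positions are counted from 0, so "among the first k" means position < k. *)

Definition clique (n : nat) (e : rel 'I_n) (S : {set 'I_n}) : Prop :=
  {in S &, forall x y, x != y -> e x y}.

Definition earlier_nbrs (n : nat) (e : rel 'I_n) (v : 'S_n) (i : 'I_n) :
    {set 'I_n} :=
  [set v j | j : 'I_n & (j < i)%N && e (v j) (v i)].

Definition maximal_degenerate_ordering (k n : nat) (e : rel 'I_n) (v : 'S_n) : Prop :=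
  [/\ (k <= n)%N,
      clique e [set v i | i : 'I_n & (i < k)%N] &
      forall i : 'I_n, (k <= i)%N -> #|earlier_nbrs e v i| = k].

(* The set M_w for the vertex w = v i. *)
Definition Mset (k n : nat) (e : rel 'I_n) (v : 'S_n) (i : 'I_n) :
    {set 'I_n} :=
  if (i < k)%N then [set v j | j : 'I_n & (j < i)%N] else earlier_nbrs e v i.

Definition ktree (k n : nat) (e : rel 'I_n) : Prop :=
  exists v : 'S_n,
    maximal_degenerate_ordering k e v /\ forall i : 'I_n, clique e (Mset k e v i).

Definition induced (n : nat) (e : rel 'I_n) (S : {set 'I_n}) : rel 'I_n :=
  [rel x y | [&& x \in S, y \in S & e x y]].

(* The relation induced e S lives on all of 'I_n, where vertices outside S are
   isolated; n_comp _ S counts only the components inside S. *)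
Definition num_components (n : nat) (e : rel 'I_n) (S : {set 'I_n}) : nat :=
  n_comp (induced e S) S.

Definition active (n : nat) (s : 'S_n) (l : nat) : {set 'I_n} :=
  [set s i | i : 'I_n & (i < l)%N].

Definition CC (R : realType) (n : nat) (e : rel 'I_n) (l : nat) : R :=
  (\sum_(s : 'S_n) (num_components e (active s l))%:R) / #|{: 'S_n}|%:R.

(* The values CC e l are nonnegative, so the default value 0 is harmless. *)
Definition maxCC (R : realType) (n : nat) (e : rel 'I_n) : R :=
  \big[Num.max/0]_(l < n.+1) CC R e l.

(* Main.v *)
(* A k-tree ordering is a perfect elimination ordering, also of every induced
   subgraph, so each component of an induced subgraph contains exactly one
   vertex without an earlier active neighbor. A vertex is of this kind iff it
   is active and its set M is inactive; M together with the vertex has size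
   |M| + 1. With g a the probability that a given set of size a is inactive,
   linearity of expectation gives
     CC[l] = \sum_i (g (min i k) - g (min i k + 1)) = 1 + (l - 1) g k,
   where g a = (n-l)(n-l-1)...(n-l-a+1) / (n(n-1)...(n-a+1)). The upper bound
   follows from g k <= (1 - l/n)^k and AM-GM. For n = (k+1) l the factors of
   g k differ from k/(k+1) by i / ((k+1)((k+1) l - i)), which yields
   l ((k/(k+1))^k - g k) <= k (k-1) / (4 (k+1)); then e <= 4 suffices. *)
Require Import Defs.
From mathcomp Require Import all_boot all_order all_algebra all_fingroup.
From mathcomp Require Import reals sequences exp ring lra zify.

Set Implicit Arguments.
Unset Strict Implicit.
Unset Printing Implicit Defensive.

Import Order.TTheory GRing.Theory Num.Theory.

Local Open Scope ring_scope.

(** * Components of a graph with a perfect elimination ordering *)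

(** Descending along earlier neighbors defines a retraction [r] onto the vertices without earlier
    neighbor. It is constant along edges, so each component holds exactly one such vertex. *)
Lemma n_comp_elimination_ordering (T : finType) (g : rel T) (pos : T -> nat)
    (S : {set T}) :
    symmetric g -> injective pos -> closed g S ->
    (forall x y z, g x y -> g x z -> (pos y < pos x)%N -> (pos z < pos x)%N ->
       y != z -> g y z) ->
  n_comp g S = #|[set x in S | [forall y, (pos y < pos x)%N ==> ~~ g x y]]|.
Proof.
move=> g_sym pos_inj S_cl simp.
have c_sym : connect_sym g by apply: sym_connect_sym.
pose L := [pred x | [forall y, (pos y < pos x)%N ==> ~~ g x y]].
pose f x := if [pick y | (pos y < pos x)%N && g x y] is Some y then y else x.
have fL x : L x -> f x = x.
  move=> /forallP Lx; rewrite /f; case: pickP => // y /andP[lt_yx gxy].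
  by have := Lx y; rewrite lt_yx gxy.
have fN x : ~~ L x -> (pos (f x) < pos x)%N && g x (f x).
  move=> /forallPn[y]; rewrite negb_imply negbK => /andP[lt_yx gxy].
  by rewrite /f; case: pickP => // /(_ y); rewrite lt_yx gxy.
have c_f x : connect g x (f x).
  case: (boolP (L x)) => [/fL -> //|/fN/andP[_ gx]]; exact: connect1.
have L_iter m x : (pos x <= m)%N -> L (iter m f x).
  elim: m x => [|m IHm] x le_xm.
    rewrite /=; apply/forallP => y.
    by move: le_xm; rewrite leqn0 => /eqP ->.
  rewrite iterSr; case: (boolP (L x)) => [Lx|/fN/andP[lt_fx _]].
    by rewrite (fL _ Lx); elim: (m) => //= p Lp; rewrite fL.
  by apply: IHm; rewrite -ltnS (leq_trans lt_fx).
(* Each step of [f] lowers [pos] or stays at a fixed point, so this many iterations always reach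
   [L]. *)
pose r x := iter (\max_y pos y) f x.
have Lr x : L (r x) by apply: L_iter; apply: leq_bigmax.
have rL x : L x -> r x = x.
  by rewrite /r => Lx; elim: (\max_y _) => //= m ->; rewrite fL.
have rf x : r (f x) = r x by rewrite /r -iterSr iterS fL.
have c_r x : connect g x (r x).
  rewrite /r; elim: (\max_y _) => //= m; move/connect_trans; exact.
(* Induction on a bound for the positions: if [y] is an earlier neighbor of [x], then [f x] and [y]
   are equal or, by [simp], joined by an edge lying before [x]. *)
have r_edge m x y : (pos x < m)%N -> (pos y < m)%N -> g x y -> r x = r y.
  elim: m x y => // m IHm.
  have aux x y : (pos x <= m)%N -> (pos y < pos x)%N -> g x y -> r x = r y.
    move=> le_xm lt_yx gxy.
    have /fN/andP[lt_fx gfx] : ~~ L x.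
      by apply/forallPn; exists y; rewrite negb_imply lt_yx negbK.
    rewrite -rf; have [-> //|ne_fy] := eqVneq (f x) y.
    apply: IHm; [exact: leq_trans lt_fx le_xm|exact: leq_trans lt_yx le_xm|].
    exact: (simp x).
  move=> x y lt_xm lt_ym gxy.
  case: (ltngtP (pos x) (pos y)) => [lt_xy|lt_yx|/pos_inj -> //].
    by apply/esym/aux => //; rewrite g_sym.
  exact: aux.
have r_connect x y : connect g x y -> r x = r y.
  case/connectP => p; elim: p x => [|z p IHp] x /=; first by move=> _ ->.
  case/andP => gxz pth ey; rewrite -(IHp z) //.
  by apply: (r_edge (maxn (pos x) (pos z)).+1) => //; rewrite ltnS ?leq_maxl ?leq_maxr.
have root_inj : {in [set x in S | L x] &, injective (fingraph.root g)}.
  move=> x y; rewrite !inE => /andP[_ Lx] /andP[_ Ly] exy.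
  rewrite -(rL _ Lx) -(rL _ Ly); apply: r_connect.
  by rewrite -(root_connect c_sym) exy.
rewrite -(card_in_imset root_inj); apply: eq_card => x; rewrite !inE.
apply/andP/imsetP => [[/eqP rx Sx]|[y]].
  exists (r x); first by rewrite inE Lr andbT -(closed_connect S_cl (c_r x)).
  by rewrite -[LHS]rx; apply/eqP; rewrite (root_connect c_sym).
rewrite inE => /andP[Sy Ly] ->; split; first exact: (roots_root c_sym).
by rewrite -(closed_connect S_cl (connect_root g y)).
Qed.

(** * Permutations mapping a given set into another *)

(** Induction on the size of [A], adding one point at a time; the cross-multiplied form keeps the
    count in [nat]. *)
Lemma card_perm_preimset (T : finType) (A B : {set T}) :
  (#|[set s : {perm T} | A \subset s @^-1: B]| * #|T| ^_ #|A|
   = #|B| ^_ #|A| * #|T|`!)%N.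
Proof.
pose h (C : {set T}) := #|[set s : {perm T} | C \subset s @^-1: B]|.
rewrite -/(h A).
move: {2}#|A| (erefl #|A|) => a; elim: a A => [|a IHa] A cA.
  move/eqP: (cA); rewrite cards_eq0 => /eqP ->.
  rewrite cards0 !ffactn0 muln1 mul1n -cardsT -card_perm.
  apply: eq_card => s; rewrite !inE sub0set.
  by apply/esym/subsetP => x _; rewrite inE.
have [x xA] : exists x, x \in A by apply/set0Pn; rewrite -cards_eq0 cA.
have cA' : #|A :\ x| = a by move: cA; rewrite (cardsD1 x) xA => -[].
rewrite -(setD1K xA) in cA *; set C := A :\ x in cA cA' *.
have xC : x \notin C by rewrite !inE eqxx.
clearbody C.
(* Precomposition with the transposition of [x] and [y] shows that the count does not depend on
   which point is added to [C]. *)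
have h_sym y : y \notin C -> h (y |: C) = h (x |: C).
  move=> yC; rewrite /h.
  have tC z : z \in C -> tperm x y z = z.
    by move=> zC; apply: tpermD; apply: contraTneq zC => <-.
  rewrite -(card_imset _ (mulgI (tperm x y))); apply: eq_card => s.
  rewrite !inE; apply/imsetP/idP => [[t]|].
    rewrite !inE !subUset !sub1set !inE => /andP[ty /subsetP tsub] ->.
    rewrite permM tpermL ty; apply/subsetP => z zC.
    by rewrite inE permM tC //; have := tsub z zC; rewrite inE.
  rewrite !subUset !sub1set !inE => /andP[sx /subsetP ssub].
  exists (tperm x y * s)%g; last by rewrite mulgA tperm2 mul1g.
  rewrite !inE !subUset !sub1set !inE permM tpermR sx.
  apply/subsetP => z zC.
  by rewrite inE permM tC //; have := ssub z zC; rewrite inE.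
(* Double counting of pairs [(s, y)] with [y] outside [C] and [s] mapping [y |: C] into [B]: each
   [s] mapping [C] into [B] admits [#|B| - a] choices of [y]. *)
have double : (h (x |: C) * (#|T| - a) = h C * (#|B| - a))%N.
  have -> : (#|T| - a = #|~: C|)%N by rewrite cardsCs setCK cA'.
  have -> : (h (x |: C) * #|~: C| = \sum_(y in ~: C) h (y |: C))%N.
    by rewrite mulnC -sum_nat_const; apply: eq_bigr => y; rewrite inE => /h_sym ->.
  under eq_bigr => y _ do rewrite /h -sum1_card big_mkcond /=.
  rewrite exchange_big /= /h -[X in (X * _)%N]sum1_card big_distrl /=.
  rewrite [RHS]big_mkcond /=; apply: eq_bigr => s _; rewrite inE mul1n.
  case: ifP => [Csub|Csub].
    have -> : (#|B| - a = #|s @^-1: B :\: C|)%N.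
      by rewrite cardsD (setIidPr Csub) cA' card_preimset //; exact: perm_inj.
    rewrite -sum1_card [RHS]big_mkcond [LHS]big_mkcond /=; apply: eq_bigr => y _.
    by rewrite !inE subUset sub1set inE Csub andbT; case: (y \in C); case: (s y \in B).
  by apply: big1 => y _; rewrite inE subUset Csub andbF.
have cxC : #|x |: C| = a.+1 by rewrite cardsU1 xC cA'.
rewrite cxC !ffactnSr.
by rewrite mulnCA double mulnA [(_ * h _)%N]mulnC -{1}cA' IHa // cA' mulnAC.
Qed.

(** * Earlier neighbors in a k-tree ordering *)

Lemma card_ord_lt (m n : nat) :
  (m <= n)%N -> #|[set i : 'I_n | (i < m)%N]| = m.
Proof.
move=> le_mn; rewrite -sum1dep_card -(big_ord_widen _ (fun=> 1%N) le_mn).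
by rewrite sum1_card card_ord.
Qed.

Lemma mem_earlier_nbrs (n : nat) (e : rel 'I_n) (v : 'S_n) (i j : 'I_n) :
  (v j \in earlier_nbrs e v i) = (j < i)%N && e (v j) (v i).
Proof. by rewrite mem_imset ?inE //; exact: perm_inj. Qed.

(** The initial vertices form a clique, so there every earlier vertex is a neighbor and the case
    distinction in [Mset] disappears. *)
Lemma Mset_earlier_nbrs (k n : nat) (e : rel 'I_n) (v : 'S_n) (i : 'I_n) :
  maximal_degenerate_ordering k e v -> Mset k e v i = earlier_nbrs e v i.
Proof.
case=> _ clq _; rewrite /Mset; case: ltnP => // lt_ik.
apply/setP => x; rewrite -[x](permKV v) mem_earlier_nbrs.
rewrite mem_imset ?inE; last exact: perm_inj.
case: ltnP => //= lt_ji; apply/esym/clq; rewrite ?mem_imset ?inE //; try exact: perm_inj.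
  exact: ltn_trans lt_ik.
by rewrite (inj_eq perm_inj) -val_eqE /= ltn_eqF.
Qed.

Lemma card_earlier_nbrs (k n : nat) (e : rel 'I_n) (v : 'S_n) (i : 'I_n) :
  maximal_degenerate_ordering k e v -> #|earlier_nbrs e v i| = minn i k.
Proof.
move=> dv; have [_ _ deg] := dv; case: (leqP k i) => [le_ki|lt_ik].
  by rewrite deg // (minn_idPr le_ki).
rewrite -(Mset_earlier_nbrs i dv) /Mset lt_ik card_imset; last exact: perm_inj.
by rewrite -[RHS](card_ord_lt (ltnW (ltn_ord i))) cardsE.
Qed.

(** The elimination lemma applies with positions given by the inverse of [v]: two earlier active
    neighbors of a vertex lie in its clique [Mset]. *)
Lemma num_components_earlier_nbrs (k n : nat) (e : rel 'I_n) (v : 'S_n)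
    (S : {set 'I_n}) :
    symmetric e -> maximal_degenerate_ordering k e v ->
    (forall i, clique e (Mset k e v i)) ->
  num_components e S
  = (\sum_(i < n) ((v i \in S) && [disjoint earlier_nbrs e v i & S]))%N.
Proof.
move=> e_sym dv clq.
rewrite /num_components /induced (@n_comp_elimination_ordering _ _ (val \o (v^-1)%g)).
- rewrite -sum1_card big_mkcond (reindex_inj (@perm_inj _ v)) /=.
  apply: eq_bigr => i _; rewrite inE /=.
  have [Si|//] := boolP (v i \in S); rewrite permK /=.
  congr (nat_of_bool _) => //; rewrite disjoint_subset.
  apply/forallP/subsetP => [Li x|Li x].
    rewrite -[x](permKV v) mem_earlier_nbrs => /andP[lt_ji eji].
    by have := Li (v ((v^-1)%g x)); rewrite permK lt_ji e_sym eji andbT inE.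
  rewrite -[x](permKV v) permK; apply/implyP => lt_ji.
  rewrite negb_and -implybE; apply/implyP => Sj; apply/negP => eij.
  have := Li (v ((v^-1)%g x)); rewrite mem_earlier_nbrs lt_ji e_sym eij.
  by move=> /(_ isT); rewrite inE Sj.
- by move=> x y /=; rewrite /induced /= e_sym; case: (x \in S); case: (y \in S).
- by move=> x y /= /val_inj /perm_inj.
- by move=> x y /and3P[-> ->].
move=> x y z /=; rewrite -[x](permKV v) -[y](permKV v) -[z](permKV v) !permK.
move=> /and3P[Sx Sy exy] /and3P[_ Sz exz] lt_yx lt_zx ne_yz.
apply/and3P; split=> //.
apply: (clq ((v^-1)%g x)) => //; rewrite (Mset_earlier_nbrs _ dv) mem_earlier_nbrs;
  by rewrite ?lt_yx ?lt_zx e_sym.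
Qed.

(** * The exact formula for the expected number of components *)

(** This is [g a] of the overview; the numerator vanishes once [a] exceeds [n - l]. *)
Definition avoid_prob (R : realType) (n l a : nat) : R :=
  ((n - l) ^_ a)%:R / (n ^_ a)%:R.

Lemma disjoint_active_prob (R : realType) (n l : nat) (A : {set 'I_n}) :
    (l <= n)%N ->
  (\sum_(s : 'S_n) ([disjoint A & active s l] : nat)%:R) / #|{: 'S_n}|%:R
  = avoid_prob R n l #|A|.
Proof.
move=> le_ln; pose B := [set i : 'I_n | (l <= i)%N].
have cB : #|B| = (n - l)%N.
  have -> : B = ~: [set i : 'I_n | (i < l)%N].
    by apply/setP => i; rewrite !inE leqNgt.
  by rewrite cardsCs setCK card_ord card_ord_lt.
have -> : \sum_(s : 'S_n) ([disjoint A & active s l] : nat)%:R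
    = #|[set s : 'S_n | A \subset s @^-1: B]|%:R :> R.
  (* [A] avoids [active s l] iff the inverse of [s] sends [A] into the positions from [l] on, hence
     the reindexing by inverses. *)
  rewrite -natr_sum (reindex_inj invg_inj) -sum1_card [in RHS]big_mkcond /=.
  congr _%:R; apply: eq_bigr => s _; rewrite inE.
  rewrite (_ : [disjoint A & _] = (A \subset s @^-1: B)); first by case: ifP.
  rewrite disjoint_subset; apply: eq_subset_r => x; rewrite !inE.
  rewrite -{1}[x](permK s) /active mem_imset ?inE -?leqNgt //; exact: perm_inj.
have := card_perm_preimset A B; rewrite cB card_ord.
have leA : (#|A| <= n)%N by rewrite -[n in (_ <= n)%N]card_ord max_card.
have := ffact_gt0 n #|A|; rewrite leA => ff0.
move/(congr1 (fun m => m%:R : R)); rewrite !natrM /avoid_prob => eqR.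
rewrite card_Sn.
by apply/eqP; rewrite eqr_div ?eqR // pnatr_eq0 -lt0n ?fact_gt0.
Qed.

Lemma CC_avoid_prob (R : realType) (k n : nat) (e : rel 'I_n) (l : nat) :
    symmetric e -> ktree k e -> (l <= n)%N ->
  CC R e l = 1 + (l%:R - 1) * avoid_prob R n l k.
Proof.
move=> e_sym [v [dv clq]] le_ln; have [le_kn _ _] := dv.
pose g := avoid_prob R n l.
have -> : CC R e l = \sum_(0 <= i < n) (g (minn i k) - g (minn i k).+1).
  rewrite big_mkord /CC.
  under eq_bigr => s _ do rewrite (num_components_earlier_nbrs _ e_sym dv clq) natr_sum.
  rewrite exchange_big /= big_distrl /=; apply: eq_bigr => i _.
  have vi : v i \notin earlier_nbrs e v i by rewrite mem_earlier_nbrs ltnn.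
  rewrite -(card_earlier_nbrs i dv).
  have -> : (#|earlier_nbrs e v i|.+1 = #|v i |: earlier_nbrs e v i|)%N.
    by rewrite cardsU1 vi.
  rewrite /g -!disjoint_active_prob // -mulrBl -sumrB; congr (_ / _).
  apply: eq_bigr => s _; rewrite !disjoints_subset subUset sub1set inE.
  by case: (v i \in _); case: (_ \subset _); rewrite ?subr0 ?subrr.
have g0 : g 0%N = 1 by rewrite /g /avoid_prob !ffactn0 divr1.
rewrite (big_cat_nat (leq0n k) le_kn) //=.
have -> : \sum_(0 <= i < k) (g (minn i k) - g (minn i k).+1) = 1 - g k.
  rewrite big_nat_cond.
  under eq_bigr => i /andP[/andP[_ lt_ik] _] do rewrite (minn_idPl (ltnW lt_ik)) -opprB.
  by rewrite -big_nat_cond sumrN telescope_sumr // opprB g0.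
have -> : \sum_(k <= i < n) (g (minn i k) - g (minn i k).+1) = l%:R * g k.
  rewrite big_nat_cond.
  under eq_bigr => i /andP[/andP[le_ki _] _] do rewrite (minn_idPr le_ki).
  rewrite -big_nat_cond sumr_const_nat -[LHS]mulr_natl.
  rewrite /g /avoid_prob !ffactnSr !natrM.
  have ffk : (n ^_ k)%:R != 0 :> R by rewrite pnatr_eq0 -lt0n ffact_gt0.
  (* In general [(n - k) * (g k - g k.+1) = l * g k]. Truncated subtraction matters only for
     [k > n - l], where [g k = 0]; for [n = k] the sum is empty, and [l = 0] or [g k = 0]. *)
  have [lt_kn|ge_kn] := ltnP k n.
    have nk : (n - k)%:R != 0 :> R by rewrite pnatr_eq0 -lt0n subn_gt0.
    have [le_k|lt_k] := leqP k (n - l).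
      by rewrite !natrB //; move: nk; rewrite natrB // => nk; field; rewrite ffk.
    by rewrite ffact_small // !(mul0r, subr0, mulr0).
  have -> : n = k by apply/eqP; rewrite eqn_leq le_kn ge_kn.
  rewrite subnn mul0r; have [-> | l_gt0] := posnP l; first by rewrite mul0r.
  rewrite ffact_small ?mul0r ?mulr0 //; move: le_ln le_kn ge_kn l_gt0; lia.
by rewrite -/(g k) mulrBl mul1r -addrA [- _ + _]addrC.
Qed.

(** * The upper bound *)

Lemma avoid_prob_ge0 (R : realType) (n l a : nat) : 0 <= avoid_prob R n l a.
Proof. by rewrite divr_ge0 ?ler0n. Qed.

Lemma avoid_probS (R : realType) (n l a : nat) :
  avoid_prob R n l a.+1 = avoid_prob R n l a * ((n - l - a)%:R / (n - a)%:R).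
Proof. by rewrite /avoid_prob !ffactnSr !natrM mulf_div. Qed.

(** Each factor [(n - l - a) / (n - a)] is at most [(n - l) / n]. *)
Lemma avoid_prob_le (R : realType) (n l a : nat) :
  (a <= n)%N -> avoid_prob R n l a <= ((n - l)%:R / n%:R) ^+ a.
Proof.
elim: a => [|a IHa] lt_an; first by rewrite /avoid_prob !ffactn0 divr1.
rewrite avoid_probS exprSr ler_pM ?avoid_prob_ge0 ?divr_ge0 ?ler0n ?IHa 1?ltnW //.
rewrite ler_pdivrMr ?ltr0n ?subn_gt0 // mulrAC ler_pdivlMr ?ltr0n ?(leq_ltn_trans _ lt_an) //.
by rewrite -!natrM ler_nat; move: lt_an; nia.
Qed.

(* AM-GM for the k + 1 numbers [k x, 1 - x, ..., 1 - x]. *)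
Lemma mul_onem_expr_le (R : realFieldType) (k : nat) (x : R) :
    (0 < k)%N -> 0 <= x <= 1 ->
  x * (1 - x) ^+ k <= k%:R ^+ k / k.+1%:R ^+ k.+1.
Proof.
move=> k_gt0 /andP[x_ge0 x_le1].
pose E (i : 'I_k.+1) : R := if i == ord0 then k%:R * x else 1 - x.
have E_ge0 : {in 'I_k.+1, forall i, 0 <= E i}.
  by move=> i _; rewrite /E; case: ifP => _; rewrite ?mulr_ge0 ?subr_ge0.
have [+ _] := leif_AGM E_ge0.
rewrite card_ord !big_ord_recl /E eqxx /=.
rewrite sumr_const prodr_const card_ord -[(1 - x) *+ k]mulr_natl.
have -> : k%:R * x + k%:R * (1 - x) = k%:R :> R by ring.
have k0 : 0 < k%:R :> R by rewrite ltr0n.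
by rewrite expr_div_n [k%:R ^+ _.+1]exprS -!mulrA ler_pM2l.
Qed.

Lemma avoid_prob_le1 (R : realType) (n l a : nat) :
  (a <= n)%N -> avoid_prob R n l a <= 1.
Proof.
move=> le_an; apply: le_trans (avoid_prob_le _ _ le_an) _.
have [->|n_gt0] := posnP n; first by rewrite invr0 mulr0 exprn_ile1.
rewrite exprn_ile1 ?divr_ge0 ?ler0n // ler_pdivrMr ?ltr0n //.
by rewrite mul1r ler_nat leq_subr.
Qed.

Lemma avoid_prob_upper (R : realType) (k n l : nat) :
    (0 < k)%N -> (k <= n)%N -> (l <= n)%N ->
  (l%:R - 1) * avoid_prob R n l k < k%:R ^+ k / k.+1%:R ^+ k.+1 * n%:R.
Proof.
move=> k_gt0 le_kn le_ln; have n_gt0 := leq_trans k_gt0 le_kn.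
have n0 : 0 < n%:R :> R by rewrite ltr0n.
(* Strictness comes from replacing [l - 1] by [l], which needs a positive probability; otherwise the
   left side is 0. *)
have /orP[/eqP ->|q_gt0] : (avoid_prob R n l k == 0) || (0 < avoid_prob R n l k).
- by rewrite eq_sym -le_eqVlt avoid_prob_ge0.
- by rewrite mulr0 mulr_gt0 // divr_gt0 // exprn_gt0 ?ltr0n.
apply: (@lt_le_trans _ _ (l%:R * avoid_prob R n l k)).
  by rewrite ltr_pM2r // gtrBl.
apply: (le_trans (ler_wpM2l (ler0n _ _) (avoid_prob_le _ l le_kn))).
rewrite -ler_pdivrMr // mulrAC natrB // mulrBl divff ?gt_eqF //.
apply: mul_onem_expr_le => //.
by rewrite divr_ge0 ?ler0n //= ler_pdivrMr // mul1r ler_nat.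
Qed.

(** * The lower bound at [n = (k+1) l] *)

(** From [expR (- (1/2)) >= 1 - 1/2] follows [expR (1/2) <= 2]; squaring gives the bound. *)
Lemma expR1_le4 (R : realType) : expR 1 <= 4 :> R.
Proof.
have h : 1 / 2 <= expR (- (1 / 2)) :> R.
  by apply: le_trans (expR_ge1Dx _); lra.
have h0 : 0 < expR (1 / 2) :> R by exact: expR_gt0.
have hm : expR (1 / 2) * expR (- (1 / 2)) = 1 :> R.
  by rewrite expRN divff // gt_eqF.
have -> : 1 = 1 / 2 + 1 / 2 :> R by field.
rewrite expRD; nra.
Qed.

(** Factor by factor, [p r - q f = r (p - q) + q (r - f)]: factor number [a], counted from 0, adds
    at most [a / (2 (k+1))] to the scaled error, and these terms sum to the bound. *)
Lemma avoid_prob_approx (R : realType) (k l a : nat) :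
    (0 < l)%N -> (a <= k)%N ->
  l%:R * ((k%:R / k.+1%:R) ^+ a - avoid_prob R (k.+1 * l) l a)
  <= a%:R * (a%:R - 1) / (4 * k.+1%:R).
Proof.
move=> l_gt0; elim: a => [|a IHa] lt_ak.
  by rewrite /avoid_prob !ffactn0 divr1 expr0 subrr mulr0 !mul0r.
have {}IHa := IHa (ltnW lt_ak).
have q_le : avoid_prob R (k.+1 * l) l a <= 1 by apply: avoid_prob_le1; nia.
have q_ge0 := avoid_prob_ge0 R (k.+1 * l) l a.
rewrite avoid_probS exprSr.
set q := avoid_prob _ _ _ _ in IHa q_le q_ge0 *.
set p := (k%:R / _) ^+ a in IHa *; clearbody p q.
have lt_al : (a < k * l)%N by nia.
have -> : (k.+1 * l - l - a = k * l - a)%N by rewrite mulSn addKn.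
rewrite !natrB ?(ltnW lt_al) //; last by nia.
rewrite !natrM.
have l1 : 1 <= l%:R :> R by rewrite ler1n.
have a0 : 0 <= a%:R :> R by rewrite ler0n.
have ak : a%:R + 1 <= k%:R :> R by rewrite natr1 ler_nat.
(* Recorded before passing to real variables, since it fails for reals strictly between 0 and 1. *)
have aa : 0 <= a%:R * (a%:R - 1) :> R.
  by case: (a) => [|b]; rewrite ?mul0r // -natr1 addrK mulr_ge0 ?addr_ge0.
rewrite -[a.+1%:R]natr1 -[k.+1%:R]natr1 in IHa *.
move: (l%:R) (a%:R) (k%:R) l1 a0 ak aa IHa => L A K l1 a0 ak aa IHa.
have D_ge : 2 * L <= (K + 1) * L - A by nra.
have D_gt0 : 0 < (K + 1) * L - A by lra.
have K1 : 0 < K + 1 by lra.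
set r := K / (K + 1).
have r01 : 0 <= r <= 1.
  by rewrite /r divr_ge0 ?ler_pdivrMr //; lra.
set f := (K * L - A) / _.
have rf : r - f = A / ((K + 1) * ((K + 1) * L - A)).
  by rewrite /r /f; field; rewrite !gt_eqF.
have Lrf0 : 0 <= L * (r - f).
  rewrite rf mulr_ge0 ?divr_ge0 ?mulr_ge0; lra.
have Lrf : L * (r - f) <= A / (2 * (K + 1)).
  rewrite rf mulrA ler_pdivrMr ?mulr_gt0 // mulrAC ler_pdivlMr ?mulr_gt0 //.
  have := ler_wpM2l (mulr_ge0 a0 (ltW K1)) D_ge; lra.
have -> : L * (p * r - q * f) = r * (L * (p - q)) + q * (L * (r - f)) by ring.
set B := A * (A - 1) / (4 * (K + 1)) in IHa.
have B_eq : (A + 1) * (A + 1 - 1) / (4 * (K + 1)) = B + A / (2 * (K + 1)).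
  by rewrite /B; field; rewrite gt_eqF.
have B_ge0 : 0 <= B by rewrite /B divr_ge0 // mulr_ge0 // ltW.
have [r_ge0 r_le1] := andP r01.
rewrite B_eq lerD //.
  by apply: le_trans (ler_wpM2l r_ge0 IHa) _; rewrite ler_piMl.
by apply: le_trans Lrf; rewrite ler_piMl.
Qed.

(** After cancellation the claim reads [Y + q < 1 + (k+2) / e], where the scaled error [Y] is at
    most [k/4], [q <= 1], and [(k+2) / e >= (k+2) / 4]. *)
Lemma avoid_prob_lower (R : realType) (k l : nat) :
    (0 < l)%N ->
  k%:R ^+ k / k.+1%:R ^+ k.+1 * (k.+1 * l)%:R - k.+2%:R / expR 1
    < 1 + (l%:R - 1) * avoid_prob R (k.+1 * l) l k.
Proof.
move=> l_gt0; have := avoid_prob_approx R l_gt0 (leqnn k).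
have k1 : k.+1%:R != 0 :> R by rewrite pnatr_eq0.
rewrite natrM; set q := avoid_prob _ _ _ _ => approx.
have -> : k%:R ^+ k / k.+1%:R ^+ k.+1 * (k.+1%:R * l%:R)
    = l%:R * (k%:R / k.+1%:R) ^+ k :> R.
  rewrite expr_div_n exprS; have := expf_neq0 k k1.
  by move: (_ ^+ k) k1 (_ ^+ k) => P; move: (k.+1%:R) => K1 K1_neq0 Q ?; field; apply/andP.
have q_le1 : q <= 1 by apply: avoid_prob_le1; nia.
have e_inv : 1 / 4 <= (expR 1)^-1 :> R.
  by rewrite div1r lef_pV2 ?posrE ?expR_gt0 // expR1_le4.
have err : k.+2%:R / 4 <= k.+2%:R / expR 1 :> R.
  by rewrite ler_wpM2l ?ler0n // -div1r.
have small : k%:R * (k%:R - 1) / (4 * k.+1%:R) <= k%:R / 4 :> R.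
  rewrite ler_pdivrMr ?mulr_gt0 ?ltr0n // -[k.+1%:R]natr1.
  have := ler0n R k; nra.
have -> : l%:R * (k%:R / k.+1%:R) ^+ k
    = l%:R * ((k%:R / k.+1%:R) ^+ k - q) + l%:R * q :> R by ring.
have k2 : k.+2%:R = k%:R + 2 :> R by rewrite -addn2 natrD.
have {approx small} := le_trans approx small.
move: err; rewrite {1}k2.
set X := k.+2%:R / _; set Y := l%:R * (_ - q).
by move: X Y => X Y; rewrite mulrBl mul1r; lra.
Qed.

Theorem theorem4p1 (R : realType) (k n : nat) (e : rel 'I_n)
    (k_ge1 : (1 <= k)%N) (e_sym : symmetric e) (e_irr : irreflexive e)
    (e_ktree : ktree k e) :
  let c : R := k%:R ^+ k / k.+1%:R ^+ k.+1 in
  maxCC R e < c * n%:R + 1 /\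
  ((k.+1 %| n)%N ->
   [/\ c * n%:R - (k.+2)%:R / expR 1 < CC R e (n %/ k.+1)%N,
       CC R e (n %/ k.+1)%N <= maxCC R e &
       maxCC R e < c * n%:R + 1]).
Proof.
move=> c; have [v [[le_kn _ _] _]] := e_ktree.
have upper : maxCC R e < c * n%:R + 1.
  (* The default value 0 of the maximum must lie below the bound as well. *)
  apply: bigmax_lt => [|l _].
    by rewrite ltr_pwDr // mulr_ge0 ?divr_ge0 ?exprn_ge0.
  have le_ln : (l <= n)%N by rewrite -ltnS.
  rewrite (CC_avoid_prob R e_sym e_ktree le_ln) addrC ltrD2r.
  exact: avoid_prob_upper.
split=> // dvd_n; have le_ln : (n %/ k.+1 <= n)%N by apply: leq_div.
split=> //; last first.
  have lt_ln : (n %/ k.+1 < n.+1)%N by rewrite ltnS.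
  exact: (le_bigmax 0 (fun l : 'I_n.+1 => CC R e l) (Ordinal lt_ln)).
rewrite (CC_avoid_prob R e_sym e_ktree le_ln).
have n_eq : n = (k.+1 * (n %/ k.+1))%N by rewrite mulnC divnK.
(* As [n >= k >= 1], divisibility forces [n >= k+1]. *)
have l_gt0 : (0 < n %/ k.+1)%N by rewrite divn_gt0 // dvdn_leq // (leq_trans k_ge1).
by have := avoid_prob_lower R k l_gt0; rewrite -n_eq.
Qed.
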